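(* Let $n\ge 1$, let $q$ be a prime power, and let $\sigma$ be a composition of $n$. Let $Y$ be a subset of $\mathrm{GL}(n,q)$ that is transitive on $\sigma$-flags. Then $Y$ is also transitive on $\tau$-flags for all compositions $\tau$ of $n$ satisfying $\tilde\sigma\unlhd\tilde\tau$, where $\tilde\sigma$ and $\tilde\tau$ are the partitions obtained from $\sigma$ and $\tau$, respectively, by rearranging the parts in nonincreasing order.
   Context: A composition of $n$ is a finite sequence of positive integers with sum $n$; a partition of $n$ is a nonincreasing composition of $n$ (extended by zeros when convenient). For partitions $\lambda,\mu$ of $n$, $\mu\unlhd\lambda$ ($\lambda$ dominates $\mu$) means $\sum_{i=1}^k\mu_i\le\sum_{i=1}^k\lambda_i$ for all $k\ge1$. For a composition $\lambda=(\lambda_1,\dots,\lambda_m)$ of $n$, a $\lambda$-flag is a sequence $(V_1,\dots,V_m)$ of subspaces of $\mathbb{F}_q^n$ with $\{0\}=V_0\le V_1\le\cdots\le V_m=\mathbb{F}_q^n$ and $\dim(V_i/V_{i-1})=\lambda_i$ for each $i$. The group $\mathrm{GL}(n,q)$ acts on $\lambda$-flags in the natural way. A subset $Y$ (not necessarily a subgroup) of a group $G$ acting on a set $\Omega$ is transitive on $\Omega$ if there is a constant $r$ such that for all $a,b\in\Omega$ there are exactly $r$ elements $g\in Y$ with $ga=b$. *)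

(* Defs.v *)
From HB Require Import structures.
From mathcomp Require Import all_boot all_order all_fingroup all_algebra.

Set Implicit Arguments.
Unset Strict Implicit.
Unset Printing Implicit Defensive.

Definition is_composition (n : nat) (s : seq nat) : bool :=
  all (leq 1) s && (sumn s == n).

Definition sorted_parts (s : seq nat) : seq nat := sort geq s.

(* [dominated mu lam] is [mu <| lam]; [nth 0] extends both by zeros. *)
Definition dominated (mu lam : seq nat) : Prop :=
  forall k : nat, 1 <= k ->
    \sum_(i < k) nth 0 mu i <= \sum_(i < k) nth 0 lam i.

(* The matrices of [{'GL_n[F]}] have size [n.-1.+1], which is [n] when [0 < n];
   the space they act on is written with the same index. *)
Definition col_space (F : finFieldType) (n : nat) := {vspace 'cV[F]_n.-1.+1}.

(* [V] lists V_1, ..., V_m; V_0 is the seed of [path], [last] and [pairmap].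
   Under the inclusions checked by [path], dim (V_i / V_(i-1)) is the
   difference of the dimensions and the subtraction does not truncate. *)
Definition is_flag (F : finFieldType) (n : nat) (lam : seq nat)
    (V : seq (col_space F n)) : bool :=
  [&& size V == size lam,
      path (fun U W => (U <= W)%VS) 0%VS V,
      last 0%VS V == fullv
    & pairmap (fun U W => \dim W - \dim U) 0%VS V == lam].

Definition GL_flag_act (F : finFieldType) (n : nat) (g : {'GL_n[F]})
    (V : seq (col_space F n)) : seq (col_space F n) :=
  [seq (linfun (mulmx (GLval g)) @: U)%VS | U <- V].

(* MathComp's [{action _ &-> _}] is a right action; [act] is a left one. *)
Definition transitive_on (gT : finGroupType) (T : eqType)
    (act : gT -> T -> T) (Omega : pred T) (Y : {set gT}) : Prop :=
  exists r : nat, forall a b : T, Omega a -> Omega b ->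
    #|[set g in Y | act g a == b]| = r.

Definition transitive_on_flags (F : finFieldType) (n : nat) (lam : seq nat)
    (Y : {set {'GL_n[F]}}) : Prop :=
  transitive_on (@GL_flag_act F n) (@is_flag F n lam) Y.

(* Main.v *)
(* Write M_lam for the permutation module of lam-flags. If there is an injective
   GL-equivariant map from M_tau to M_sigma, transitivity passes from sigma to tau.
   Rearranging two adjacent parts (a, b) into (c, d) with a + b = c + d and
   max(a, b) <= max(c, d) changes one member of the flag, inside an interval [A, B]
   of subspaces; the required injection is Kantor's theorem that the inclusion
   matrix between k- and l-subspaces of an N-space has full rank when
   k <= l <= N - k. Such moves, with parts equal to zero allowed, permute the parts
   arbitrarily and generate the dominance order.

   Kantor's theorem, in the dual form for k >= l >= N - k: let f live on the
   k-subspaces, put S(X, T) = sum of f(W) over X <= W <= T, and assume S(X, V) = 0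
   when dim X = l. If T is a hyperplane of T0, then the sum of S(X + <v>, T0) over
   the vectors v of T0 outside T is (q^k - q^(k-1)) (S(X, T0) - S(X, T)), so that
   S(X, T) = 0 whenever dim X <= l - codim T, and S(0, W) = f(W) for dim W = k. *)
Require Import Defs.
From HB Require Import structures.
From mathcomp Require Import all_boot all_order all_fingroup all_algebra all_field.
From mathcomp Require Import zify.
Set Implicit Arguments.
Unset Strict Implicit.
Unset Printing Implicit Defensive.
Import GRing.Theory Num.Theory.
(* The subtype structure of [{vspace _}], needed for its finiteness, is exported only here. *)
Import VectorInternalTheory.

HB.instance Definition _ (F : finFieldType) (vT : vectType F) :=
  [Finite of {vspace vT} by <:].

(** * Kantor's theorem on subspace inclusion *)

Section Kantor.
Variables (F : finFieldType) (n : nat).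
Local Notation V := 'cV[F]_n.
Implicit Types (A B T U W X : {vspace V}) (f : {vspace V} -> rat).

Lemma dimv_add_line U (v : V) : v \notin U -> \dim (U + <[v]>) = (\dim U).+1.
Proof.
move=> vU; have v0 : v != 0%R by apply: contraNneq vU => ->; exact: mem0v.
rewrite dimv_disjoint_sum ?dim_vline ?v0 ?addn1 //.
apply/eqP; rewrite -subv0; apply/subvP=> w; rewrite memv_cap => /andP[wU].
case/vlineP=> c def_w; rewrite def_w memv0 in wU *.
have [->|c0] := eqVneq c 0%R; first by rewrite scale0r.
by case/negP: vU; rewrite -(scalerK c0 v) memvZ.
Qed.

Lemma card_vspace_diff W T :
  #|[set v | (v \in W) && (v \notin T)]| = #|F| ^ \dim W - #|F| ^ \dim (W :&: T).
Proof.
have cardE U : #|F| ^ \dim U = #|[set v in U]| by rewrite cardsE card_vspace.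
rewrite !cardE -(cardsID [set v in T] [set v in W]).
have -> : [set v in W] :&: [set v in T] = [set v in (W :&: T)%VS].
  by apply/setP=> v; rewrite !inE memv_cap.
by rewrite addKn; apply: eq_card => v; rewrite !inE andbC.
Qed.

Definition interval_sum f X T : rat := (\sum_(W | (X <= W)%VS && (W <= T)%VS) f W)%R.

(** Double count of pairs [v], [W]: a [W] above [X] lies above [X + <[v]>] exactly when it contains
    [v], so it occurs once for each of its vectors outside [T']. *)
Lemma sum_interval_sum_add_line f X T T' :
  (T' <= T)%VS ->
  (\sum_(v | (v \in T) && (v \notin T')) interval_sum f (X + <[v]>) T =
   \sum_(W | (X <= W)%VS && (W <= T)%VS)
     (#|F| ^ \dim W - #|F| ^ \dim (W :&: T'))%:R * f W)%R.
Proof.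
move=> sT'T; rewrite /interval_sum.
rewrite (exchange_big_dep (fun W => (X <= W)%VS && (W <= T)%VS)) /=; last first.
  by move=> v W _; rewrite subv_add -andbA => /and3P[-> _ ->].
apply: eq_bigr => W /andP[XW WT]; rewrite sumr_const -card_vspace_diff mulr_natl.
congr (_ *+ _)%R; apply: eq_card => v; rewrite !inE unfold_in /=.
rewrite subv_add XW WT andbT -memvE /=.
case vW: (v \in W); last by rewrite andbF.
by rewrite (subvP WT _ vW) andbT.
Qed.

Lemma subv_add_line U T (v : V) : (U + <[v]> <= T)%VS = (U <= T)%VS && (v \in T).
Proof. by rewrite subv_add memvE. Qed.

Lemma ltn_expn_card : {mono expn #|F| : a b / a < b}.
Proof. by move=> a b; rewrite ltn_exp2l // finNzRing_gt1. Qed.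

Section Down.
Variables (A B : {vspace V}) (f : {vspace V} -> rat) (k l : nat).
Hypotheses (lk : l <= k) (dimABkl : \dim A + \dim B <= k + l).
Hypothesis supp_f : forall W, f W != 0%R -> [&& (A <= W)%VS, (W <= B)%VS & \dim W == k].
Hypothesis sum_f : forall X, (A <= X)%VS -> (X <= B)%VS -> \dim X = l ->
  (\sum_(W | (X <= W)%VS) f W = 0)%R.

(** Descending induction on [\dim X] from [l]: the sums at [X + <[v]>] vanish and add up to q^k -
    q^(dim X) times the sum at [X], a nonzero factor because dim X < l <= k. *)
Lemma interval_sum_ambient X : (A <= X)%VS -> (X <= B)%VS -> \dim X <= l ->
  interval_sum f X B = 0%R.
Proof.
move=> AX XB /subnKC; move: (l - \dim X) => m.
elim: m X AX XB => [|m IH] X AX XB dimX.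
  rewrite -[RHS](sum_f AX XB); last by rewrite -dimX addn0.
  rewrite /interval_sum big_mkcondr; apply: eq_bigr => W _.
  by case: ifPn => // WB; have [//|/supp_f /and3P[_ /(elimN idP)]] := eqVneq (f W) 0%R.
have := sum_interval_sum_add_line f X XB; rewrite big1; last first.
  move=> v /andP[vB vX]; apply: IH; last by rewrite dimv_add_line // addSnnS.
    exact: subv_trans AX (addvSl _ _).
  by rewrite subv_add_line XB.
rewrite (eq_bigr (fun W => (#|F| ^ k - #|F| ^ \dim X)%:R * f W)%R); last first.
  move=> W /andP[XW _]; rewrite (capv_idPr XW).
  by have [->|/supp_f /and3P[_ _ /eqP->]] := eqVneq (f W) 0%R; rewrite ?mulr0.
rewrite -mulr_sumr => /esym/eqP; rewrite mulf_eq0 pnatr_eq0 subn_eq0 leqNgt.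
have -> /= : #|F| ^ \dim X < #|F| ^ k.
  by rewrite ltn_expn_card (leq_trans _ lk) // -dimX addnS ltnS leq_addr.
by move/eqP.
Qed.

Lemma interval_sum_eq0 X T : (A <= X)%VS -> (X <= B)%VS -> (A <= T)%VS -> (T <= B)%VS ->
  \dim X + \dim B <= l + \dim T -> interval_sum f X T = 0%R.
Proof.
move=> AX XB AT TB; have := dimvS TB => /subnKC.
move: (\dim B - \dim T) => t; elim: t X T AX XB AT TB => [|t IH] X T AX XB AT TB dimT dimXT.
  have -> : T = B by apply/eqP; rewrite -(dimv_leqif_eq TB) -dimT addn0.
  by apply: interval_sum_ambient => //; move: dimXT; rewrite -dimT addn0 leq_add2r.
have [x xB xT] : exists2 x, x \in B & x \notin T.
  apply/subvPn/negP=> BT; have := dimvS BT; by rewrite -dimT; clear; lia.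
pose T0 := (T + <[x]>)%VS.
have dimT0 : \dim T0 = (\dim T).+1 by rewrite dimv_add_line.
have TT0 : (T <= T0)%VS := addvSl _ _.
have AT0 := subv_trans AT TT0.
have T0B : (T0 <= B)%VS by rewrite subv_add_line TB.
have S0 : interval_sum f X T0 = 0%R.
  by apply: IH => //; move: dimT dimXT; rewrite ?dimT0; clear; lia.
have := sum_interval_sum_add_line f X TT0; rewrite big1; last first.
  move=> v /andP[vT0 vT]; have vB := subvP T0B _ vT0.
  (* [X] need not lie in [T], so [v] may already belong to [X]; the term is then the sum in [S0]. *)
  have [vX|vX] := boolP (v \in X).
    by have/addv_idPl-> : (<[v]> <= X)%VS by rewrite -memvE.
  apply: IH => //; rewrite ?subv_add_line ?XB ?dimv_add_line //.
  - exact: subv_trans AX (addvSl _ _).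
  - by move: dimT; rewrite ?dimT0; clear; lia.
  by move: dimT dimXT; rewrite ?dimT0; clear; lia.
(* Subspaces of [T] get weight zero; any other [W] of dimension [k] spans [T0] together with [T],
   hence meets [T] in dimension [k.-1]. *)
rewrite (bigID (fun W => (W <= T)%VS)) /= big1 ?add0r; last first.
  by move=> W /andP[_ WT]; rewrite (capv_idPl WT) subnn mul0r.
have XT W : (X <= W)%VS && (W <= T0)%VS && (W <= T)%VS = (X <= W)%VS && (W <= T)%VS.
  by case WT : (W <= T)%VS; rewrite ?andbF // (subv_trans WT TT0) andbT.
rewrite (eq_bigr (fun W => (#|F| ^ k - #|F| ^ k.-1)%:R * f W)%R); last first.
  move=> W /andP[/andP[XW WT0] WT].
  have [->|/supp_f /and3P[_ _ /eqP dimW]] := eqVneq (f W) 0%R; first by rewrite ?mulr0.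
  have : (W + T == T0)%VS.
    rewrite -dimv_leqif_eq ?subv_add ?WT0 ?TT0 // dimT0 eqn_leq.
    rewrite -{1}dimT0 dimvS ?subv_add ?WT0 //=.
    rewrite ltn_neqAle dimvS ?addvSr // andbT dimv_leqif_eq ?addvSr //.
    by apply: contraNneq WT => ->; exact: addvSl.
  move=> /eqP sumWT; have := dimv_sum_cap W T; rewrite sumWT dimT0 dimW => dim_cap.
  by rewrite (_ : \dim _ = k.-1) //; move: dim_cap; clear; lia.
move: S0; rewrite /interval_sum (bigID (fun W => (W <= T)%VS)) /=.
rewrite (eq_bigl _ _ XT) => S0.
rewrite -mulr_sumr => /esym/eqP; rewrite mulf_eq0 pnatr_eq0 subn_eq0 leqNgt.
(* [k] is positive: [T] is proper in [B], so [dimXT] forces 0 < l, and l <= k. *)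
rewrite ltn_expn_card; have -> /= : k.-1 < k by move: dimT dimXT lk dimABkl; clear; lia.
by move/eqP=> S1; rewrite S1 addr0 in S0.
Qed.

(** [dimABkl] is the condition l >= N - k for dimensions taken modulo [A], and is what
    [interval_sum_eq0] asks for at [X := A], [T := W]. *)
Lemma kantor_down W : f W = 0%R.
Proof.
have [//|fW] := eqVneq (f W) 0%R; have /and3P[AW WB /eqP dimW] := supp_f fW.
have := interval_sum_eq0 (subvv A) (subv_trans AW WB) AW WB.
rewrite dimW [l + k]addnC => /(_ dimABkl).
rewrite /interval_sum (bigD1 W) /=; last by rewrite AW subvv.
rewrite big1 ?addr0 // => U /andP[/andP[AU UW] UneW].
have [//|/supp_f /and3P[_ _ /eqP dimU]] := eqVneq (f U) 0%R.
by case/eqP: UneW; apply/eqP; rewrite -dimv_leqif_eq // dimU dimW.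
Qed.
End Down.

(** * Orthogonal complements and the dual form of Kantor's theorem *)

Lemma dim_cV m : \dim {:'cV[F]_m} = m.
Proof. by rewrite dimvf /dim /= muln1. Qed.

Lemma dim_le U : \dim U <= n.
Proof. by rewrite -[in X in _ <= X](dim_cV n) dimvS ?subvf. Qed.

Definition dot_basis U : 'Hom(V, 'cV[F]_(\dim U)) :=
  linfun (mulmx (\matrix_(i, j) ((vbasis U)`_i)%R j ord0)).

Definition perp U : {vspace V} := lker (dot_basis U).

Lemma perpP U (v : V) : reflect (forall u, u \in U -> (u^T *m v = 0)%R) (v \in perp U).
Proof.
rewrite memv_ker lfunE /=.
apply: (iffP eqP) => [Uv0 u uU | Uv0].
  rewrite (coord_vbasis uU) linear_sum mulmx_suml big1 // => i _.
  rewrite linearZ -scalemxAl -[RHS](scaler0 _ (coord (vbasis U) i u)); congr (_ *: _)%R.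
  apply/matrixP=> j j'; rewrite !ord1 !mxE.
  have /matrixP/(_ i ord0) := Uv0; rewrite [LHS]mxE [RHS]mxE => Uv0i; rewrite -[RHS]Uv0i.
  by apply: eq_bigr => k _; rewrite !mxE.
apply/matrixP=> i j; rewrite !ord1.
have /Uv0/matrixP/(_ ord0 ord0) : ((vbasis U)`_i)%R \in U.
  by rewrite vbasis_mem ?mem_nth ?size_tuple.
rewrite !mxE => E; rewrite -[RHS]E; by apply: eq_bigr => k _; rewrite !mxE.
Qed.

Lemma dim_perp_ge U : n <= \dim U + \dim (perp U).
Proof.
rewrite -[in X in X <= _](dim_cV n) -(limg_ker_dim (dot_basis U) {:V}) capfv addnC leq_add2r.
by rewrite (leq_trans (dimvS (subvf _))) // dim_cV.
Qed.

(** [dim_perp_ge] bounds [perp U] and [perp U^C] from below; a vector in both is orthogonal to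
    everything, so they are independent and both bounds are attained. *)
Lemma dim_perp U : \dim (perp U) = n - \dim U.
Proof.
have capp : (perp U :&: perp U^C)%VS = 0%VS.
  apply/eqP; rewrite -subv0; apply/subvP=> v; rewrite memv_cap => /andP[/perpP vU /perpP vUC].
  have v_perp (u : V) : (u^T *m v = 0)%R.
    have : u \in (U + U^C)%VS by rewrite addv_complf memvf.
    by case/memv_addP=> u1 /vU u1v [u2 /vUC u2v ->]; rewrite linearD mulmxDl u1v u2v addr0.
  rewrite memv0; apply/eqP/matrixP=> i j; rewrite !ord1 mxE.
  have /matrixP/(_ ord0 ord0) := v_perp (delta_mx i ord0).
  by rewrite trmx_delta -rowE !mxE.
have := dim_perp_ge U; have := dim_perp_ge U^C; rewrite dimv_compl dim_cV.
have := dimv_disjoint_sum capp; have := dim_le (perp U + perp U^C); have := dim_le U.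
by clear; lia.
Qed.

Lemma perpS U W : (U <= W)%VS -> (perp W <= perp U)%VS.
Proof.
by move=> /subvP UW; apply/subvP=> v /perpP vW; apply/perpP=> u /UW; apply: vW.
Qed.

Lemma perpK : involutive perp.
Proof.
move=> U; apply/esym/eqP; rewrite -dimv_leqif_eq ?dim_perp; last first.
  apply/subvP=> v vU; apply/perpP=> u /perpP/(_ v vU) /(congr1 trmx).
  by rewrite trmx_mul trmxK trmx0.
by rewrite subKn // dim_le.
Qed.

Lemma perp_sub U W : (perp U <= perp W)%VS = (W <= U)%VS.
Proof. by apply/idP/idP => [/perpS|/perpS//]; rewrite !perpK. Qed.

(** [perp] reverses inclusion and exchanges dimension with codimension, which reduces this to
    [kantor_down] between [perp B] and [perp A]. *)
Lemma kantor_up A B f k l : k <= l -> l <= \dim B -> k + l <= \dim A + \dim B ->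
  (forall W, f W != 0%R -> [&& (A <= W)%VS, (W <= B)%VS & \dim W == k]) ->
  (forall X, (A <= X)%VS -> (X <= B)%VS -> \dim X = l ->
    (\sum_(W | (W <= X)%VS) f W = 0)%R) ->
  forall W, f W = 0%R.
Proof.
move=> kl lB klAB supp_f sum_f W.
rewrite -[W]perpK.
apply: (@kantor_down (perp B) (perp A) (fun U => f (perp U)) (n - k) (n - l)).
- by move: kl; clear; lia.
- rewrite !dim_perp; have := dim_le A; have := dim_le B; move: klAB; clear; lia.
- move=> U /supp_f /and3P[AU UB /eqP dimU].
  by rewrite -[U]perpK !perp_sub AU UB dim_perp dimU eqxx.
move=> X BX XA dimX; rewrite (reindex_inj (can_inj perpK)) /=.
rewrite -[RHS](sum_f (perp X)).
- by apply: eq_big => U; rewrite ?perpK // -{1}[X]perpK perp_sub.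
- by rewrite -perp_sub perpK.
- by rewrite -perp_sub perpK.
by rewrite dim_perp dimX subKn // (leq_trans lB) ?dim_le.
Qed.
End Kantor.

(** * The dominance order *)

Section Transfers.
Variable R : seq nat -> seq nat -> Prop.
Hypotheses (R_refl : forall s, R s s) (R_trans : forall s t u, R s t -> R t u -> R s u).
Hypothesis R_cons : forall x s t, R s t -> R (x :: s) (x :: t).
Hypothesis R_pair : forall a b c d s, a + b = c + d -> maxn a b <= maxn c d ->
  R [:: a, b & s] [:: c, d & s].

Lemma transfer_cat s t u : R t u -> R (s ++ t) (s ++ u).
Proof. by move=> Rtu; elim: s => [|x s IH] //=; apply: R_cons. Qed.

(** An adjacent swap is an [R_pair] move with equal maxima; such swaps bring the head of [t] to the
    front of [s]. *)
Lemma transfer_perm s t : perm_eq s t -> R s t.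
Proof.
elim: t s => [|x t IH] s; first by move/perm_nilP->.
move=> st; have xs : x \in s by rewrite (perm_mem st) mem_head.
have [s1 [s2 def_s]] : exists s1 s2, s = s1 ++ x :: s2.
  by case/splitPr: xs => s1 s2; exists s1, s2.
rewrite {s xs}def_s in st *.
apply: (@R_trans _ (x :: s1 ++ s2)); last first.
  by apply/R_cons/IH; rewrite -(perm_cons x) -(permPr st) -cat1s perm_catCA.
elim: s1 {st} => [|y s1 IHs] //=.
by apply: R_trans (R_cons y IHs) _; apply: R_pair; rewrite ?[y + _]addnC // maxnC.
Qed.

Lemma sumn_take_ge x s k : all (leq x) s -> k <= size s -> k * x <= sumn (take k s).
Proof.
elim: s k => [|y s IH] [|k] //= /andP[xy xs] ks.
by rewrite mulSn leq_add ?IH.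
Qed.

Lemma sumn_take_le x s k : all (geq x) s -> sumn (take k s) <= k * x.
Proof.
elim: s k => [|y s IH] [|k] //= /andP[xy xs].
by rewrite mulSn leq_add ?IH.
Qed.

(* The first two parts of [lam] bracketing [x], the largest part of [mu], are
   replaced by [x] and their excess over [x]: what remains is still sorted and
   still dominates the tail of [mu]. *)
Lemma transfer_dominated mu lam :
  size mu = size lam -> sorted geq mu -> sorted geq lam -> sumn mu = sumn lam ->
  (forall k, sumn (take k mu) <= sumn (take k lam)) -> R mu lam.
Proof.
elim: mu lam => [|x mu IH] lam; first by case: lam.
move=> size_eq; rewrite /= => mu_sorted lam_sorted sum_eq dom.
have geq_trans : transitive geq by move=> b a c ba cb; exact: leq_trans cb ba.
have mu_le_x : all (geq x) mu by exact: order_path_min mu_sorted.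
have mu_tail : sorted geq mu by exact: path_sorted mu_sorted.
(* If all parts of [lam] exceeded [x], its sum would exceed that of [mu]. *)
have [x_lt_lam|/allPn[y0 y0lam y0x]] := boolP (all (ltn x) lam).
  have := sumn_take_ge x_lt_lam (leqnn _); rewrite take_size -sum_eq leqNgt => /negP[].
  have /(sumn_take_le (size (x :: mu))) : all (geq x) (x :: mu) by rewrite /= leqnn.
  by rewrite take_size mulnS -size_eq /=; clear; lia.
have has_le : has (geq x) lam by apply/hasP; exists y0; rewrite //= leqNgt.
case/split_find: has_le lam_sorted size_eq sum_eq dom {y0 y0x y0lam} => y lam1 lam2 /= yx.
(* [y] is the first part of [lam] that is at most [x]. If it is the head, dominance at 1 gives y =
   x; otherwise its predecessor [z] exceeds [x]. *)
case/lastP: lam1 => [|l0 z] /=.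
  move=> _ lam_sorted [size_eq] sum_eq dom.
  have xy : x <= y by have := dom 1; rewrite /= !take0 /= !addn0.
  have def_y : y = x by apply/eqP; rewrite eqn_leq xy andbT; exact: yx.
  rewrite def_y in sum_eq dom *; apply/R_cons/IH => //; first exact: path_sorted lam_sorted.
  - exact: addnI sum_eq.
  by move=> k; have := dom k.+1; rewrite /= leq_add2l.
rewrite has_rcons negb_or -ltnNge => /andP[xz /hasPn l0x].
rewrite !cat_rcons => lam_sorted size_eq sum_eq dom.
(* From y <= x < z follows y <= w <= z, which keeps the list sorted and makes (x, w) to (z, y) an
   [R_pair] move. *)
pose w := z + y - x.
apply: (@R_trans _ (x :: l0 ++ w :: lam2)).
  apply/R_cons/IH => //.
  - by move: size_eq; rewrite !size_cat /= !addnS => -[].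
  - move: lam_sorted; rewrite !(sorted_pairwise geq_trans) !pairwise_cat !allrel_consr /=.
    case/and3P=> /and3P[l0z l0y l0_lam2] -> /and3P[/andP[zy z_lam2] y_lam2 ->].
    rewrite l0_lam2 !andbT /=; apply/andP; split.
      by apply: sub_all l0z => v /=; apply: leq_trans; rewrite /w; move: yx; clear; lia.
    apply: sub_all y_lam2 => v /= vy; apply: leq_trans vy _.
    by rewrite /w; move: xz; clear; lia.
  - by move: sum_eq; rewrite !sumn_cat /= /w; move: xz; clear; lia.
  (* Inside [l0] each part is compared with [x]. Beyond it, the first [k.+1] parts of the old list
     contain both [z] and [y], and [x] cancels. *)
  move=> k; have [kl0|l0k] := leqP k (size l0).
    rewrite takel_cat //; apply: leq_trans (sumn_take_le k mu_le_x) _.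
    by apply: sumn_take_ge => //; apply/allP=> v /l0x; rewrite -ltnNge => /ltnW.
  have := dom k.+1; rewrite take_cat [in X in _ -> X]take_cat !ltnNge.
  rewrite (ltnW l0k) (leqW (ltnW l0k)) /=.
  rewrite subSn ?(ltnW l0k) // -(subnSK l0k) /= !sumn_cat /= /w; move: xz; clear; lia.
apply: (@R_trans _ (l0 ++ [:: x, w & lam2])).
  by apply: transfer_perm; rewrite -cat1s perm_catCA.
by apply/transfer_cat/R_pair; rewrite /w; move: xz yx; clear; lia.
Qed.
End Transfers.

(** * Flags *)

Section Flags.
Variables (F : finFieldType) (n : nat).
Local Notation subspace := (col_space F n).
Implicit Types (U W X B P : subspace) (V v : seq subspace).
Implicit Types (g h : {'GL_n[F]}) (s lam : seq nat).

Definition GL_space g U : subspace := (linfun (mulmx (GLval g)) @: U)%VS.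

Lemma GL_spaceM g h U : GL_space (g * h)%g U = GL_space g (GL_space h U).
Proof.
rewrite /GL_space -limg_comp; congr (lfun_img _ _).
by apply/lfunP=> x; rewrite comp_lfunE !lfunE /= -mulmxA.
Qed.

Lemma GL_space1 U : GL_space 1%g U = U.
Proof.
rewrite /GL_space (_ : linfun _ = \1%VF) ?lim1g //.
by apply/lfunP=> x; rewrite id_lfunE lfunE /= mul1mx.
Qed.

Lemma GL_spaceK g : cancel (GL_space g) (GL_space g^-1%g).
Proof. by move=> U; rewrite -GL_spaceM mulVg GL_space1. Qed.

Lemma GL_spaceVK g : cancel (GL_space g^-1%g) (GL_space g).
Proof. by move=> U; rewrite -GL_spaceM mulgV GL_space1. Qed.

Lemma GL_spaceS g U W : (GL_space g U <= GL_space g W)%VS = (U <= W)%VS.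
Proof.
have GL_spaceS h U' W' : (U' <= W')%VS -> (GL_space h U' <= GL_space h W')%VS by exact: limgS.
by apply/idP/idP => [/(GL_spaceS g^-1%g)|/GL_spaceS//]; rewrite !GL_spaceK.
Qed.

Lemma dim_GL_space g U : \dim (GL_space g U) = \dim U.
Proof.
have dim_le h W : \dim (GL_space h W) <= \dim W.
  by rewrite -(limg_ker_dim (linfun (mulmx (GLval h))) W) leq_addl.
by apply/eqP; rewrite eqn_leq dim_le -{1}(GL_spaceK g U) dim_le.
Qed.

Lemma GL_space_full g : GL_space g fullv = fullv.
Proof. by apply/eqP; rewrite -dimv_leqif_eq ?subvf ?dim_GL_space. Qed.

Lemma GL_flag_actK g : cancel (GL_flag_act g) (GL_flag_act g^-1%g).
Proof. exact: mapK (GL_spaceK g). Qed.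

(** Recursive form of [is_flag], with the initial subspace free so that induction on the flag
    applies. *)
Fixpoint flag_above U lam V : bool :=
  match lam, V with
  | a :: lam', W :: V' => [&& (U <= W)%VS, \dim W - \dim U == a & flag_above W lam' V']
  | [::], [::] => U == fullv
  | _, _ => false
  end.

Lemma is_flagE lam V : is_flag lam V = flag_above 0%VS lam V.
Proof.
rewrite /is_flag; elim: V lam 0%VS => [|W V IH] [|a lam] U //=; first by rewrite !andbT.
rewrite -IH eqSS eqseq_cons; case: (size V == size lam) => //=; last by rewrite !andbF.
by case: (U <= W)%VS => //=; case: (_ == a); rewrite ?andbF.
Qed.

Lemma flag_above_act g U lam V :
  flag_above (GL_space g U) lam (GL_flag_act g V) = flag_above U lam V.
Proof.
elim: lam U V => [|a lam IH] U [|W V] //=; last first.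
  by rewrite -/(GL_space g W) IH GL_spaceS !dim_GL_space.
by rewrite -{1}(GL_space_full g) (can_eq (GL_spaceK g)).
Qed.

Lemma is_flag_act g lam V : is_flag lam (GL_flag_act g V) = is_flag lam V.
Proof. by rewrite !is_flagE -[RHS](flag_above_act g) /GL_space limg0. Qed.

Lemma flag_above_rcons U lam V W :
  flag_above U (rcons lam 0) (rcons V W) = flag_above U lam V && (W == fullv).
Proof.
elim: lam U V => [|a lam IH] U [|X V] /=.
- apply/and3P/andP=> [[UW dimW /eqP Wf]|[/eqP-> /eqP->]]; last by rewrite subvv subnn !eqxx.
  split; last exact/eqP.
  by move: UW dimW; rewrite Wf subn_eq0 eqEdim => ->.
- by case: V => [|? ?]; rewrite /= !andbF.
- by case: lam {IH} => [|? ?]; rewrite /= !andbF.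
by rewrite IH !andbA.
Qed.

Lemma is_flag_rcons lam V W :
  is_flag (rcons lam 0) (rcons V W) = is_flag lam V && (W == fullv).
Proof. by rewrite !is_flagE flag_above_rcons. Qed.

(** Deleting [P] merges the parts [a] and [b]; only the last condition constrains [P] once the other
    members are fixed. *)
Lemma flag_above_refine U s1 a b s2 v1 P B v2 : size v1 = size s1 ->
  flag_above U (s1 ++ [:: a, b & s2]) (v1 ++ [:: P, B & v2]) =
  flag_above U (s1 ++ a + b :: s2) (v1 ++ B :: v2) &&
  [&& (last U v1 <= P)%VS, (P <= B)%VS & \dim P == \dim (last U v1) + a].
Proof.
elim: s1 U v1 => [|x s1 IH] U [|W v1] //=; last by move=> [size_v1]; rewrite IH // !andbA.
move=> _; case: (flag_above B s2 v2); rewrite ?andbF // !andbT.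
apply/idP/idP; last first.
  case/andP=> /andP[UB /eqP dimB] /and3P[-> -> /eqP->].
  by move: dimB (dimvS UB); clear; lia.
case/and4P=> UP /eqP<- PB /eqP<-.
by rewrite UP PB (subv_trans UP PB) /=; move: (dimvS UP) (dimvS PB); clear; lia.
Qed.

Lemma flag_above_mid U s1 e s2 v1 B v2 : size v1 = size s1 ->
  flag_above U (s1 ++ e :: s2) (v1 ++ B :: v2) ->
  (last U v1 <= B)%VS /\ \dim B = \dim (last U v1) + e.
Proof.
elim: s1 U v1 => [|x s1 IH] U [|W v1] //=; last by move=> [size_v1] /and3P[_ _]; exact: IH.
by move=> _ /and3P[UB /eqP<- _]; rewrite subnKC ?dimvS.
Qed.
End Flags.

(** * Transitivity on flags *)

Section FlagTransitivity.
Variables (F : finFieldType) (n : nat).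
Local Notation subspace := (col_space F n).
Implicit Types (U A B P Q X : subspace) (V W v w : seq subspace).
Implicit Types (g h : {'GL_n[F]}) (s lam : seq nat) (Y : {set {'GL_n[F]}}).

Definition flag_count Y V W := #|[set g in Y | GL_flag_act g V == W]|.

Lemma flag_countV Y V W : flag_count (Y^-1)%g V W = flag_count Y W V.
Proof.
rewrite /flag_count -(card_imset _ (can_inj (@invgK _))); congr #|pred_of_set _|.
apply/setP=> g; rewrite !inE; apply/imsetP/andP=> [[h]|[gY /eqP gW]].
  by rewrite !inE => /andP[hY /eqP<-] ->; rewrite hY GL_flag_actK eqxx.
by exists g^-1%g; rewrite ?inE ?invgK // gY -gW GL_flag_actK eqxx.
Qed.

(** Any [g0] in [Y] is counted for [V] and its image, so [r] is positive and every pair of flags is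
    joined. *)
Lemma flag_count_const_transitive s Y r V W : Y != set0 ->
  (forall V' W', is_flag s V' -> is_flag s W' -> flag_count Y V' W' = r) ->
  is_flag s V -> is_flag s W -> exists g, GL_flag_act g V = W.
Proof.
case/set0Pn=> g0 g0Y countY flagV flagW; have : flag_count Y V W != 0.
  rewrite (countY _ _ flagV flagW) -(countY V (GL_flag_act g0 V)) ?is_flag_act //.
  by apply/eqP=> /card0_eq /(_ g0); rewrite !inE g0Y eqxx.
by rewrite -lt0n => /card_gt0P[g]; rewrite inE => /andP[_ /eqP]; exists g.
Qed.

(* [I] is inclusion or reverse inclusion, and [I_inj] is Kantor's theorem for it in an
   interval [[A, B]]. *)
Section Fibre.
Variables (I : rel subspace) (a b c d : nat) (s1 s2 : seq nat).
Hypothesis abcd : a + b = c + d.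
Hypothesis I_GL : forall g X U, I (GL_space g X) (GL_space g U) = I X U.
Hypothesis I_inj : forall A B (f : subspace -> rat),
  (A <= B)%VS -> \dim B = \dim A + (a + b) ->
  (forall U, f U != 0%R -> [&& (A <= U)%VS, (U <= B)%VS & \dim U == \dim A + c]) ->
  (forall X, (A <= X)%VS -> (X <= B)%VS -> \dim X = \dim A + a ->
     (\sum_(U | I X U) f U = 0)%R) ->
  forall U, f U = 0%R.
Let sigma := s1 ++ [:: a, b & s2].
Let tau := s1 ++ [:: c, d & s2].

Definition context_set Y v1 v2 w1 w2 :=
  [set g in Y | (GL_flag_act g v1 == w1) && (GL_flag_act g v2 == w2)].

Lemma flag_count_context Y v1 P v2 w1 U w2 : size v1 = size w1 ->
  flag_count Y (v1 ++ P :: v2) (w1 ++ U :: w2) =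
  #|[set g in context_set Y v1 v2 w1 w2 | GL_space g P == U]|.
Proof.
move=> size_vw; apply: eq_card => g; rewrite !inE -!andbA; congr (_ && _).
rewrite /GL_flag_act map_cat /= eqseq_cat ?size_map // eqseq_cons -/(GL_space g P).
by rewrite [(_ == U) && _]andbC.
Qed.

(** Groups the elements [g] on the right by the image of [P]. [sum_flag_count_below] groups the same
    set by the preimage of [X], so the two sums agree. *)
Lemma sum_flag_count_above Y v1 P v2 w1 X w2 : size v1 = size w1 ->
  is_flag tau (v1 ++ P :: v2) ->
  \sum_(U | is_flag tau (w1 ++ U :: w2) && I X U)
    flag_count Y (v1 ++ P :: v2) (w1 ++ U :: w2) =
  #|[set g in context_set Y v1 v2 w1 w2 | I X (GL_space g P)]|.
Proof.
move=> size_vw flagP; rewrite -sum1_card.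
rewrite (partition_big (fun g => GL_space g P)
  (fun U => is_flag tau (w1 ++ U :: w2) && I X U)) /=.
  apply: eq_bigr => U /andP[_ XU]; rewrite flag_count_context // -sum1_card.
  apply: eq_bigl => g; rewrite !inE -!andbA; do 3!congr (_ && _).
  by case: eqP => [->|]; rewrite ?XU ?andbF.
move=> g; rewrite !inE => /andP[/andP[_ /andP[/eqP<- /eqP<-]] ->]; rewrite andbT.
rewrite -[_ ++ _]/(GL_flag_act g v1 ++ GL_flag_act g (P :: v2)).
by rewrite /GL_flag_act -map_cat is_flag_act.
Qed.

Lemma sum_flag_count_below Y v1 P v2 w1 X w2 : size v1 = size w1 ->
  is_flag sigma (w1 ++ X :: w2) ->
  \sum_(Q | is_flag sigma (v1 ++ Q :: v2) && I Q P)
    flag_count Y (v1 ++ Q :: v2) (w1 ++ X :: w2) =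
  #|[set g in context_set Y v1 v2 w1 w2 | I X (GL_space g P)]|.
Proof.
move=> size_vw flagX; rewrite -sum1_card.
rewrite (partition_big (fun g => GL_space g^-1%g X)
  (fun Q => is_flag sigma (v1 ++ Q :: v2) && I Q P)) /=.
  apply: eq_bigr => Q /andP[_ QP]; rewrite flag_count_context // -sum1_card.
  apply: eq_bigl => g; rewrite !inE -!andbA; do 3!congr (_ && _).
  rewrite -(can_eq (GL_spaceK g) _ Q) GL_spaceVK [X == _]eq_sym.
  by case: eqP => [<-|]; rewrite ?I_GL ?QP ?andbF.
move=> g; rewrite !inE => /andP[/andP[_ /andP[/eqP def_w1 /eqP def_w2]] XP].
rewrite -(I_GL g) GL_spaceVK XP andbT -(is_flag_act g) /GL_flag_act map_cat /=.
by rewrite -!/(GL_flag_act _ _) def_w1 def_w2 -/(GL_space g _) GL_spaceVK.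
Qed.

Definition degree s v1 v2 (R : pred subspace) :=
  #|[pred U | is_flag s (v1 ++ U :: v2) && R U]|.

Lemma degree_GL g v1 X v2 w1 X' w2 : size v1 = size w1 ->
  GL_flag_act g (v1 ++ X :: v2) = w1 ++ X' :: w2 ->
  degree tau v1 v2 (I X) = degree tau w1 w2 (I X').
Proof.
move=> size_vw /eqP; rewrite /GL_flag_act map_cat eqseq_cat ?size_map //= eqseq_cons.
case/and3P=> /eqP<- /eqP<- /eqP<-.
rewrite /degree -!sum1_card [RHS](reindex (GL_space g)) /=; last first.
  by apply: onW_bij; exists (GL_space g^-1%g); [exact: GL_spaceK | exact: GL_spaceVK].
apply: eq_bigl => U; rewrite -!topredE /= I_GL; congr (_ && _).
by rewrite -(is_flag_act g) /GL_flag_act map_cat.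
Qed.

Lemma is_flag_split_context w1 U w2 : size w1 = size s1 -> is_flag tau (w1 ++ U :: w2) ->
  exists B w3, w2 = B :: w3.
Proof.
move=> size_w1 /and4P[/eqP]; rewrite !size_cat size_w1 => /addnI /=.
by case: w2 => [|B w3] // _ _ _ _; exists B, w3.
Qed.

(** [sigma] and [tau] both refine [s1 ++ a + b :: s2], so their varying members range over one
    interval. *)
Lemma fibre_interval w1 U B w2 : size w1 = size s1 ->
  is_flag tau (w1 ++ [:: U, B & w2]) ->
  let A := last 0%VS w1 in
  [/\ (A <= B)%VS, \dim B = \dim A + (a + b),
      forall U', is_flag tau (w1 ++ [:: U', B & w2]) =
        [&& (A <= U')%VS, (U' <= B)%VS & \dim U' == \dim A + c]
    & forall X, is_flag sigma (w1 ++ [:: X, B & w2]) =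
        [&& (A <= X)%VS, (X <= B)%VS & \dim X == \dim A + a]].
Proof.
move=> size_w1; rewrite is_flagE flag_above_refine // => /andP[flagB _] A.
have [AB dimB] := flag_above_mid size_w1 flagB.
split=> //; first by rewrite abcd.
  by move=> U'; rewrite is_flagE flag_above_refine // flagB.
by move=> X; rewrite is_flagE flag_above_refine // abcd flagB.
Qed.

Lemma fibre_inj w1 U w2 (f : subspace -> rat) : size w1 = size s1 ->
  is_flag tau (w1 ++ U :: w2) ->
  (forall U', ~~ is_flag tau (w1 ++ U' :: w2) -> f U' = 0%R) ->
  (forall X, is_flag sigma (w1 ++ X :: w2) ->
     (\sum_(U' | is_flag tau (w1 ++ U' :: w2) && I X U') f U' = 0)%R) ->
  f U = 0%R.
Proof.
move=> size_w1 flagU; have [B [w3 def_w2]] := is_flag_split_context size_w1 flagU.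
rewrite {w2}def_w2 in flagU * => f0 sum_f.
have [AB dimB flag_tau flag_sigma] := fibre_interval size_w1 flagU.
apply: (I_inj AB dimB) => [U'|X AX XB /eqP dimX].
  by apply: contraNT; rewrite -flag_tau => /f0->.
rewrite -[RHS](sum_f X) ?flag_sigma ?AX ?XB // [RHS]big_mkcondl; apply: eq_bigr => U' _.
by case: ifPn => // /f0.
Qed.

(** If all degrees were zero, the indicator of [U] would satisfy the equations in [fibre_inj] and
    hence vanish. *)
Lemma degree_gt0 w1 U w2 : size w1 = size s1 -> is_flag tau (w1 ++ U :: w2) ->
  exists2 X, is_flag sigma (w1 ++ X :: w2) & 0 < degree tau w1 w2 (I X).
Proof.
move=> size_w1 flagU.
have [/existsP[X /andP[flagX degX]]|/existsPn no_deg] :=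
  boolP [exists X, is_flag sigma (w1 ++ X :: w2) && (0 < degree tau w1 w2 (I X))].
  by exists X.
suff : ((U == U)%:R = 0 :> rat)%R by rewrite eqxx => /eqP; rewrite oner_eq0.
apply: (@fibre_inj w1 U w2 (fun U' => ((U' == U)%:R)%R)) => // [U'|X flagX].
  by apply: contraNeq; rewrite pnatr_eq0 eqb0 negbK => /eqP->.
apply: big1 => U' UX; case: eqP => // UU; have := no_deg X; rewrite flagX /= lt0n negbK.
by move/eqP/card0_eq/(_ U'); rewrite !inE UX.
Qed.

(** As [U] varies, the difference of the two sides sums to zero over the [U] incident with any given
    [X'], by the double count; [fibre_inj] then makes it zero. *)
Lemma flag_count_degree Y r v1 P v2 w1 U w2 X :
  size v1 = size s1 -> size w1 = size s1 -> Y != set0 ->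
  (forall V W, is_flag sigma V -> is_flag sigma W -> flag_count Y V W = r) ->
  is_flag sigma (w1 ++ X :: w2) ->
  is_flag tau (v1 ++ P :: v2) -> is_flag tau (w1 ++ U :: w2) ->
  flag_count Y (v1 ++ P :: v2) (w1 ++ U :: w2) * degree tau w1 w2 (I X) =
  r * degree sigma v1 v2 (I^~ P).
Proof.
move=> size_v1 size_w1 Yn0 countY flagX flagP flagU.
have size_vw : size v1 = size w1 by rewrite size_v1.
pose d1 := degree tau w1 w2 (I X); pose d2 := degree sigma v1 v2 (I^~ P).
pose N U' := flag_count Y (v1 ++ P :: v2) (w1 ++ U' :: w2).
pose f U' : rat :=
  (if is_flag tau (w1 ++ U' :: w2) then (N U' * d1)%:R - (r * d2)%:R else 0)%R.
suff : f U = 0%R by rewrite /f flagU => /eqP; rewrite subr_eq0 eqr_nat => /eqP.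
apply: (fibre_inj size_w1 flagU) => [U' /negPf flagU'|X' flagX']; first by rewrite /f flagU'.
rewrite (eq_bigr (fun U' => (N U' * d1)%:R - (r * d2)%:R)%R); last first.
  by rewrite /f => U' /andP[-> _].
rewrite big_split /= -natr_sum -big_distrl /= sum_flag_count_above //.
rewrite -sum_flag_count_below // (eq_bigr (fun _ => r)); last first.
  by move=> Q /andP[flagQ _]; apply: countY.
rewrite sum_nat_const sumr_const mulNrn -mulrnA; apply/eqP; rewrite subr_eq0 eqr_nat.
(* The degree at [X'] equals that at [X], since the two flags are in one orbit. *)
have [g gX] := flag_count_const_transitive Yn0 countY flagX flagX'.
rewrite /d1 (degree_GL (erefl _) gX) /d2 /degree; apply/eqP.
by rewrite [_ * r]mulnC; congr (_ * _ * _).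
Qed.

Lemma size_flag s V : is_flag s V -> size V = size s.
Proof. by case/and4P=> /eqP. Qed.

Lemma is_flag_split V : is_flag tau V ->
  exists v1 P v2, size v1 = size s1 /\ V = v1 ++ P :: v2.
Proof.
move/size_flag; rewrite size_cat /= => size_V; rewrite -(cat_take_drop (size s1) V).
have : size (drop (size s1) V) = (size s2).+2 by rewrite size_drop size_V addKn.
case: (drop _ V) => // P v2 _; exists (take (size s1) V), P, v2; split=> //.
by rewrite size_takel // size_V leq_addr.
Qed.

(* Only the second flag varies here: [flag_count_degree] leaves a factor depending on the
   first one, which is removed afterwards by applying this to the inverse set of [Y]. *)
Lemma flag_count_const_r Y V W W' : transitive_on_flags sigma Y ->
  is_flag tau V -> is_flag tau W -> is_flag tau W' -> flag_count Y V W = flag_count Y V W'.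
Proof.
case=> r countY flagV flagW flagW'.
have [Y0|Yn0] := eqVneq Y set0.
  by rewrite /flag_count Y0; apply: eq_card => g; rewrite !inE.
have countY' V1 V2 : is_flag sigma V1 -> is_flag sigma V2 -> flag_count Y V1 V2 = r.
  exact: countY.
have [v1 [P [v2 [size_v1 def_V]]]] := is_flag_split flagV.
have [w1 [U [w2 [size_w1 def_W]]]] := is_flag_split flagW.
have [x1 [U' [x2 [size_x1 def_W']]]] := is_flag_split flagW'.
subst V W W'.
have [X flagX degX] := degree_gt0 size_w1 flagW.
have [X' flagX' degX'] := degree_gt0 size_x1 flagW'.
have e := flag_count_degree size_v1 size_w1 Yn0 countY' flagX flagV flagW.
have e' := flag_count_degree size_v1 size_x1 Yn0 countY' flagX' flagV flagW'.
have [g gX] := flag_count_const_transitive Yn0 countY' flagX flagX'.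
have degE : degree tau w1 w2 (I X) = degree tau x1 x2 (I X').
  by apply: degree_GL gX; rewrite size_w1.
by apply/eqP; rewrite -(eqn_pmul2r degX) e {1}degE e'.
Qed.

Lemma transitive_fibre Y : transitive_on_flags sigma Y -> transitive_on_flags tau Y.
Proof.
move=> transY; have transYV : transitive_on_flags sigma Y^-1%g.
  case: transY => r countY; exists r => V W flagV flagW.
  by rewrite -[LHS]/(flag_count _ V W) flag_countV; exact: countY.
have const V W V' W' : is_flag tau V -> is_flag tau W -> is_flag tau V' -> is_flag tau W' ->
    flag_count Y V W = flag_count Y V' W'.
  move=> flagV flagW flagV' flagW'; rewrite (flag_count_const_r transY flagV flagW flagW').
  rewrite -[LHS]flag_countV -[RHS]flag_countV.
  exact: (flag_count_const_r transYV flagW' flagV flagV').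
(* The constant is read off from one flag, sought among tuples because these form a finite type;
   without flags any constant works. *)
case: (pickP (fun V : (size tau).-tuple subspace => is_flag tau V)) => [V0 flagV0|no_flag].
  by exists (flag_count Y V0 V0) => V W flagV flagW; apply: const.
exists 0 => V W flagV; have := no_flag (Tuple (introT eqP (size_flag flagV))).
by rewrite /= flagV.
Qed.

End Fibre.

(** If d <= c, inclusion works: k - l is c - a, and the dimension bound reads b <= c. Otherwise
    reverse inclusion works: c <= a and c <= b follow from b <= d and a <= d. *)
Lemma transitive_rebalance p a b c d s Y : a + b = c + d -> maxn a b <= maxn c d ->
  transitive_on_flags (p ++ [:: a, b & s]) Y -> transitive_on_flags (p ++ [:: c, d & s]) Y.
Proof.
move=> abcd; rewrite geq_max => /andP[amax bmax].
have [dc|/ltnW cd] := leqP d c.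
  rewrite (maxn_idPl dc) in amax bmax.
  apply: (@transitive_fibre (fun X U => (X <= U)%VS)) => // [g X U|A B f AB dimB].
    exact: GL_spaceS.
  apply: kantor_down; first by rewrite leq_add2l.
  by rewrite dimB; move: bmax; clear; lia.
rewrite (maxn_idPr cd) in amax bmax.
apply: (@transitive_fibre (fun X U => (U <= X)%VS)) => // [g X U|A B f AB dimB].
  exact: GL_spaceS.
apply: kantor_up; first by move: abcd amax bmax; clear; lia.
  by rewrite dimB addnA leq_addr.
by rewrite dimB; move: abcd amax; clear; lia.
Qed.

(** A final zero part repeats the whole space, which every group element fixes. *)
Lemma transitive_rcons0 lam Y :
  transitive_on_flags (rcons lam 0) Y <-> transitive_on_flags lam Y.
Proof.
have act_rcons g V W :
    (GL_flag_act g (rcons V fullv) == rcons W fullv) = (GL_flag_act g V == W).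
  by rewrite /GL_flag_act map_rcons -/(GL_space g _) GL_space_full eqseq_rcons eqxx andbT.
split=> -[r countY]; exists r => V W flagV flagW.
  rewrite -(countY (rcons V fullv) (rcons W fullv)) ?is_flag_rcons ?flagV ?flagW ?eqxx //.
  by apply: eq_card => g; rewrite !inE act_rcons.
have := size_flag flagW; have := size_flag flagV; rewrite size_rcons.
case/lastP: V flagV => // V X; rewrite is_flag_rcons => /andP[flagV /eqP->] _.
case/lastP: W flagW => // W X'; rewrite is_flag_rcons => /andP[flagW /eqP->] _.
by rewrite -(countY V W flagV flagW); apply: eq_card => g; rewrite !inE act_rcons.
Qed.

Lemma transitive_pad lam m Y :
  transitive_on_flags (lam ++ nseq m 0) Y <-> transitive_on_flags lam Y.
Proof.
elim: m lam => [|m IH] lam; first by rewrite cats0.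
by rewrite -cat_rcons IH transitive_rcons0.
Qed.
End FlagTransitivity.

(** * Padding by zeros and the passage to dominance *)

Lemma sumn_take_pad s m k : sumn (take k (s ++ nseq m 0)) = \sum_(i < k) nth 0 s i.
Proof.
elim: s k => [|x s IH] k.
  rewrite big1 => [|i _]; last by rewrite nth_nil.
  by elim: m k => [|m IH] [|k] //=; rewrite IH.
by case: k => [|k] /=; rewrite ?big_ord0 ?big_ord_recl ?IH.
Qed.

Lemma sorted_pad s m : sorted geq s -> sorted geq (s ++ nseq m 0).
Proof.
have geq_trans : transitive geq by move=> b a c ba cb; exact: leq_trans cb ba.
rewrite !(sorted_pairwise geq_trans) pairwise_cat => ->.
apply/andP; split; first by apply/allrelP=> x y _ /nseqP[-> _].
by elim: m => //= m ->; rewrite andbT; apply/allP=> y /nseqP[-> _].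
Qed.

Theorem theorem1p4 (n : nat) (hn : 1 <= n) (F : finFieldType)
    (sigma : seq nat) (hsigma : is_composition n sigma)
    (Y : {set {'GL_n[F]}}) (hY : transitive_on_flags sigma Y) :
  forall tau : seq nat, is_composition n tau ->
    dominated (sorted_parts sigma) (sorted_parts tau) ->
    transitive_on_flags tau Y.
Proof.
move=> tau /andP[_ /eqP sum_tau] dom; have /andP[_ /eqP sum_sigma] := hsigma.
(* Quantifying over the prefix [p] makes [R] stable under a common head, which moves into [p]. *)
pose R s t := forall p, transitive_on_flags (p ++ s) Y -> transitive_on_flags (p ++ t) Y.
have R_refl s : R s s by [].
have R_trans s t u : R s t -> R t u -> R s u by move=> st tu p /st/tu.
have R_cons x s t : R s t -> R (x :: s) (x :: t).
  by move=> st p; rewrite -!cat_rcons; apply: st.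
have R_pair a b c d s : a + b = c + d -> maxn a b <= maxn c d -> R [:: a, b & s] [:: c, d & s].
  by move=> abcd max_le p; apply: transitive_rebalance.
have R_perm := transfer_perm R_refl R_trans R_cons R_pair.
have sort_perm s : perm_eq (sorted_parts s) s by rewrite perm_sort.
have sorted_sort s : sorted geq (sorted_parts s).
  by apply: sort_sorted => x y; exact: leq_total.
(* Each sorted list is padded by the length of the other, giving the equal lengths that
   [transfer_dominated] requires. *)
apply: (R_perm _ _ (sort_perm tau) [::]) => /=; apply/(transitive_pad _ (size sigma)).
pose padded_sigma := sorted_parts sigma ++ nseq (size tau) 0.
apply: (@transfer_dominated R _ _ _ _ padded_sigma _ _ _ _ _ _ [::]) => //=.
- by rewrite !size_cat !size_nseq !size_sort addnC.
- exact: sorted_pad.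
- exact: sorted_pad.
- by rewrite !sumn_cat !sumn_nseq !mul0n !addn0 !(perm_sumn (sort_perm _)) sum_tau.
- by case=> [|k]; rewrite ?take0 // !sumn_take_pad; exact: dom.
apply/transitive_pad; apply: (R_perm sigma _ _ [::]) => //.
by rewrite perm_sym.
Qed.
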